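(* Let $K$ be a complete algebraically closed non-Archimedean field with divisible value group. Let $(\mathcal{B},\tau,\mathcal{B}')$ be a ball system in $K$ with source balls $B_i=B(a_i,r_i)$ and target balls $B_i'=B(b_i,t_i)$, $1\le i\le N$, all radii $r_i,t_i$ lying in $|K^\times|$, and let $U=\bigcup_i B_i$. Let $\psi$ be a piecewise affine exact interpreter on $U$ given by $$\psi|_{B_i}(z)=b_{\tau(i)}+u_i(z-a_i),\qquad u_i\in K,\ |u_i|=\frac{t_{\tau(i)}}{r_i}.$$ Let $\varepsilon>0$ satisfy $$\varepsilon<\min_i |u_i|r_i=\min_i t_{\tau(i)}.$$ Then any rational function $\phi\in K(z)$ such that $\|\phi-\psi\|_U<\varepsilon$ is an exact interpreter of $\tau$, i.e. $\phi(B_i)=B'_{\tau(i)}$ for all $i$.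
   Context: For $a\in K$, $r>0$, $B(a,r)=\{z\in K:|z-a|\le r\}$. A ball system is a triple $(\mathcal{B},\tau,\mathcal{B}')$ where $\mathcal{B}=\{B_i=B(a_i,r_i)\}_{i=1}^N$ is a finite collection of pairwise disjoint closed balls, $\tau:\{1,\dots,N\}\to\{1,\dots,N\}$ is a map, and $\mathcal{B}'=\{B_i'=B(b_i,t_i)\}_{i=1}^N$ is a family of closed balls. A map $\phi$, analytic in a neighborhood of $U$ (for rational $\phi$: no poles on an open neighborhood of $U$), exactly interprets $\tau$ if $\phi(B_i)=B'_{\tau(i)}$ for all $i$. The norm is $\|h\|_U=\sup_{z\in U}|h(z)|$ (it is infinite if the rational function has a pole in $U$). *)

(* Defs.v *)
From mathcomp Require Import all_boot all_order all_algebra.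
From mathcomp Require Import all_classical all_reals ereal.

Set Implicit Arguments.
Unset Strict Implicit.
Unset Printing Implicit Defensive.

Import Order.TTheory GRing.Theory Num.Theory.
Local Open Scope classical_set_scope.
Local Open Scope ring_scope.

Notation "x %:F" := (@FracField.tofrac _ x) : ring_scope.

Section Valued.
Variables (R : realType) (K : closedFieldType) (v : K -> R).

(* The trivial absolute value is not excluded. *)
Definition nonarch_abs : Prop :=
  [/\ forall x, 0 <= v x,
      forall x, v x = 0 <-> x = 0,
      forall x y, v (x * y) = v x * v y
    & forall x y, v (x + y) <= Num.max (v x) (v y)].

Definition cauchy_for (x : nat -> K) : Prop :=
  forall e : R, 0 < e ->
    exists M : nat, forall m n, (M <= m)%N -> (M <= n)%N -> v (x m - x n) < e.

Definition converges_to (x : nat -> K) (l : K) : Prop :=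
  forall e : R, 0 < e ->
    exists M : nat, forall n, (M <= n)%N -> v (x n - l) < e.

Definition complete_abs : Prop :=
  forall x, cauchy_for x -> exists l, converges_to x l.

Definition value_group : set R := [set v x | x in [set x | x != 0]].

Definition divisible_value_group : Prop :=
  forall n : nat, (0 < n)%N ->
  forall s, value_group s -> exists2 s', value_group s' & s' ^+ n = s.

Definition cball (a : K) (r : R) : set K := [set z | v (z - a) <= r].

Definition open_abs (V : set K) : Prop :=
  forall z, V z -> exists2 e : R, 0 < e & cball z e `<=` V.

(* Evaluation of a rational function.  A fraction may be written with a
   denominator vanishing at z even when it has no pole there, so both notions
   quantify over all representations p / q. *)
Definition regular_at (phi : {fraction {poly K}}) (z : K) : Prop :=
  exists p q : {poly K}, q.[z] != 0 /\ phi = p%:F / q%:F.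

Definition rat_eval (phi : {fraction {poly K}}) (z : K) : K :=
  xget 0 [set w | exists p q : {poly K},
                    [/\ q.[z] != 0, phi = p%:F / q%:F & w = p.[z] / q.[z]]].

Lemma rat_evalE (p q : {poly K}) (z : K) :
  q.[z] != 0 -> rat_eval (p%:F / q%:F) z = p.[z] / q.[z].
Proof.
move=> qz; apply: xget_unique; first by exists p, q.
move=> w [p' [q' [q'z + ->]]].
have nz (s : {poly K}) : s.[z] != 0 -> s%:F != 0.
  by rewrite tofrac_eq0; apply: contraNneq => ->; rewrite horner0.
move=> /eqP; rewrite eqr_div ?nz // -!tofracM tofrac_eq => /eqP eq_pq.
by apply/eqP; rewrite eqr_div // -!hornerM eq_pq.
Qed.

(* ||phi - psi||_U = sup_{z in U} |phi(z) - psi(z)|, infinite if phi has a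
   pole in U. *)
Definition dist_norm (U : set K) (phi : {fraction {poly K}}) (psi : K -> K)
    : \bar R :=
  ereal_sup [set (if `[< regular_at phi z >]
                  then (v (rat_eval phi z - psi z))%:E else +oo%E) | z in U].

Section BallSystem.
Variables (N : nat) (a : 'I_N -> K) (r : 'I_N -> R) (tau : 'I_N -> 'I_N)
          (b : 'I_N -> K) (t : 'I_N -> R).

Definition ball_system : Prop :=
  [/\ forall i, 0 < r i, forall i, 0 < t i
    & trivIset setT (fun i => cball (a i) (r i))].

Definition source_union : set K := \bigcup_i cball (a i) (r i).

Definition maps_balls_exactly (f : K -> K) : Prop :=
  forall i, f @` cball (a i) (r i) = cball (b (tau i)) (t (tau i)).

Definition exact_interpreter (phi : {fraction {poly K}}) : Prop :=
  (exists V : set K, [/\ open_abs V, source_union `<=` V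
                       & forall z, V z -> regular_at phi z])
  /\ maps_balls_exactly (rat_eval phi).

(* Such a psi is affine near each point of source_union, which is open, so its
   analyticity there need not be required separately. *)
Definition piecewise_affine_exact_interpreter (u : 'I_N -> K) (psi : K -> K)
    : Prop :=
  [/\ forall i, v (u i) = t (tau i) / r i,
      forall i z, cball (a i) (r i) z -> psi z = b (tau i) + u i * (z - a i)
    & maps_balls_exactly psi].

End BallSystem.
End Valued.

(* Main.v *)
Require Import Defs.
From mathcomp Require Import all_boot all_order all_algebra.
From mathcomp Require Import all_classical all_reals ereal.
Set Implicit Arguments.
Unset Strict Implicit.
Unset Printing Implicit Defensive.
Import Order.TTheory GRing.Theory Num.Theory.
Local Open Scope classical_set_scope.
Local Open Scope ring_scope.

(** The values of [phi] stay in the target balls by the ultrametric inequality,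
    because the error [eps] is smaller than every target radius.  The point is
    surjectivity, and it rests on one fact: over an algebraically closed field a
    rational function with neither zeros nor poles in a ball has constant
    absolute value there ([v_horner_const], [v_rat_sub_const]).  Indeed every
    zero and pole [c] then lies at distance more than the radius from the
    centre, and the ultrametric inequality makes [v (z - c)] the same for all
    [z] in the ball; now factor numerator and denominator into linear factors.

    Suppose [phi] omits a value [w] of the target ball on [B(a, r)], where [psi]
    is affine of slope [u].  Then [v (phi z - w)] is constant on [B(a, r)].
    Since [psi] is exact, [psi z0 = w] for some [z0], so the constant is smaller
    than [eps].  As [r] is the absolute value of some [c], the point [z0 + c]
    belongs to the ball and [psi (z0 + c) - w = u * c] has absolute value
    [v u * r > eps], so by closeness [v (phi (z0 + c) - w) = v u * r], which is a
    contradiction ([near_affine_onto]). *)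

Section Ultrametric.
Variables (R : realType) (K : closedFieldType) (v : K -> R).
Hypothesis v_abs : nonarch_abs v.

Lemma v_ge0 x : 0 <= v x. Proof. by case: v_abs. Qed.

Lemma v0 : v 0 = 0. Proof. by case: v_abs => _ /(_ 0) [_ ->]. Qed.

Lemma vM x y : v (x * y) = v x * v y. Proof. by case: v_abs. Qed.

Lemma v1 : v 1 = 1.
Proof.
have v1_neq0 : v 1 != 0.
  apply/eqP; case: v_abs => _ /(_ 1) [v1_0 _] _ _ /v1_0 /eqP.
  by rewrite oner_eq0.
by apply: (mulfI v1_neq0); rewrite -vM !mulr1.
Qed.

Lemma vN x : v (- x) = v x.
Proof.
have /eqP : v (-1) ^+ 2 = 1 by rewrite expr2 -vM mulrNN mulr1 v1.
rewrite sqrf_eq1 => /orP[] /eqP vN1; first by rewrite -mulN1r vM vN1 mul1r.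
by have := v_ge0 (-1); rewrite vN1 lerNr oppr0 ler10.
Qed.

Lemma v_distC x y : v (x - y) = v (y - x).
Proof. by rewrite -vN opprB. Qed.

Lemma vD_le x y c : v x <= c -> v y <= c -> v (x + y) <= c.
Proof.
move=> xc yc; case: v_abs => _ _ _ /(_ x y) /le_trans; apply.
by rewrite ge_max xc.
Qed.

Lemma vD_lt x y c : v x < c -> v y < c -> v (x + y) < c.
Proof.
move=> xc yc; case: v_abs => _ _ _ /(_ x y) /le_lt_trans; apply.
by rewrite gt_max xc.
Qed.

Lemma vD_dominant x y : v y < v x -> v (x + y) = v x.
Proof.
move=> yx; apply/eqP; rewrite eq_le vD_le ?(ltW yx) //= leNgt.
apply/negP => xyx; have : v (x + y - y) < v x by apply: vD_lt; rewrite ?vN.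
by rewrite addrK ltxx.
Qed.

Lemma cball_center a r : 0 <= r -> cball v a r a.
Proof. by rewrite /cball /= subrr v0. Qed.

(** Every point of an ultrametric ball is a centre of it. *)
Lemma cballP a r y z : cball v a r y -> cball v a r z <-> v (z - y) <= r.
Proof.
move=> ay; split=> yz.
  have -> : z - y = (z - a) + (a - y) by rewrite [RHS]addrA subrK.
  by apply: vD_le => //; rewrite v_distC.
by rewrite /cball /= -(subrK y z) -addrA; apply: vD_le.
Qed.

Lemma v_sub_const a r c z :
  ~ cball v a r c -> cball v a r z -> v (z - c) = v (a - c).
Proof.
move=> /negP; rewrite -ltNge => ac az.
have -> : z - c = (a - c) + (z - a) by rewrite [RHS]addrC addrA subrK.
by apply: vD_dominant; rewrite (v_distC a); apply: le_lt_trans ac.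
Qed.

(** Algebraic closedness enters here: absence of roots in the ball controls
    every linear factor of [p]. *)
Lemma v_horner_const (p : {poly K}) a r z :
  (forall x, cball v a r x -> p.[x] != 0) -> cball v a r z ->
  v p.[z] = v p.[a].
Proof.
have [s ->] := closed_field_poly_normal p => p_neq0 az.
have {p_neq0} : forall c, c \in s -> ~ cball v a r c.
  move=> c cs /p_neq0; rewrite hornerZ (rootP _) ?mulr0 ?eqxx //.
  by rewrite root_prod_XsubC.
rewrite !hornerZ !vM => s_out; congr (_ * _).
elim: s s_out => [|c s IHs] s_out; first by rewrite big_nil !hornerC.
rewrite !big_cons !hornerM !hornerXsubC !vM IHs => [|x xs].
  by rewrite (v_sub_const _ az) //; apply: s_out; rewrite mem_head.
by apply: s_out; rewrite in_cons xs orbT.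
Qed.

(** Regularity only provides a representation that depends on the point.  In
    lowest terms the denominator cannot vanish where some other representation
    has a nonzero denominator, so a single fraction computes [phi] on a whole
    ball and its numerator and denominator can be factored. *)
Lemma regular_reduced (phi : {fraction {poly K}}) y : regular_at phi y ->
  exists p q : {poly K},
    phi = p%:F / q%:F /\ forall z, regular_at phi z -> q.[z] != 0.
Proof.
move=> [p [q [qy ->]]].
have q_neq0 : q != 0 by apply: contraNneq qy => ->; rewrite horner0.
have co : coprimep (p %/ gcdp p q) (q %/ gcdp p q).
  by rewrite coprimep_div_gcd // q_neq0 orbT.
have pE := divpK (dvdp_gcdl p q); have qE := divpK (dvdp_gcdr p q).
move: co pE qE.
move: (gcdp p q) (p %/ gcdp p q) (q %/ gcdp p q) => g p1 q1 co pE qE.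
have [q1_neq0 g_neq0] : q1 != 0 /\ g != 0.
  by apply/andP; rewrite -negb_or -mulf_eq0 qE.
have -> : p%:F / q%:F = p1%:F / q1%:F.
  by apply/eqP; rewrite eqr_div ?tofrac_eq0 // -!tofracM -pE -qE mulrAC mulrA.
exists p1, q1; split=> // z [p' [q' [q'z]]].
have q'_neq0 : q' != 0 by apply: contraNneq q'z => ->; rewrite horner0.
move=> /eqP; rewrite eqr_div ?tofrac_eq0 // -!tofracM tofrac_eq => /eqP pq.
apply/negP => q1z; have : (p1 * q').[z] != 0.
  by rewrite hornerM mulf_neq0 // (coprimep_root _ q1z) // coprimep_sym.
by rewrite pq hornerM (eqP q1z) mulr0 eqxx.
Qed.

Lemma v_rat_sub_const (phi : {fraction {poly K}}) a r w z :
    (forall x, cball v a r x -> regular_at phi x) ->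
    (forall x, cball v a r x -> rat_eval phi x != w) -> cball v a r z ->
  v (rat_eval phi z - w) = v (rat_eval phi a - w).
Proof.
move=> reg omits az.
have aa : cball v a r a.
  by apply: cball_center; apply: le_trans az; apply: v_ge0.
have [p [q [phiE q_reg]]] := regular_reduced (reg _ aa).
have q_neq0 x : cball v a r x -> q.[x] != 0 by move=> /reg/q_reg.
have phi_sub x : cball v a r x ->
    (rat_eval phi x - w) * q.[x] = (p - w *: q).[x].
  move=> /q_neq0 qx.
  by rewrite phiE rat_evalE // hornerD hornerN hornerZ mulrBl divfK.
have num_neq0 x : cball v a r x -> (p - w *: q).[x] != 0.
  by move=> ax; rewrite -phi_sub // mulf_neq0 ?q_neq0 // subr_eq0 omits.
have vq_neq0 : v q.[a] != 0.
  by apply/eqP; case: v_abs => _ v0P _ _ /v0P /eqP; apply/negP/q_neq0.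
apply: (mulIf vq_neq0); rewrite -[in LHS](v_horner_const q_neq0 az) -!vM.
by rewrite !phi_sub // (v_horner_const num_neq0 az).
Qed.

(** A pole in [U] would make the norm infinite, so closeness also yields
    regularity. *)
Lemma dist_norm_lt (U : set K) (phi : {fraction {poly K}}) (psi : K -> K) e z :
    (dist_norm v U phi psi < e%:E)%E -> U z ->
  regular_at phi z /\ v (rat_eval phi z - psi z) < e.
Proof.
move=> norm_lt Uz.
have : ((if `[< regular_at phi z >] then (v (rat_eval phi z - psi z))%:E
         else +oo) < e%:E)%E.
  by apply: le_lt_trans norm_lt; apply: ereal_sup_ubound; exists z.
by case: asboolP => // reg; rewrite lte_fin.
Qed.

(** The affine map takes values at distance [0] and [v u * r] from [w] on the
    ball.  An error below [v u * r] keeps these distances apart for [phi], which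
    [v_rat_sub_const] forbids if [phi] omits [w]. *)
Lemma near_affine_onto (phi : {fraction {poly K}}) a r b u e w z0 :
    value_group v r -> e < v u * r ->
    (forall z, cball v a r z ->
       regular_at phi z /\ v (rat_eval phi z - (b + u * (z - a))) < e) ->
    cball v a r z0 -> b + u * (z0 - a) = w ->
  exists2 z, cball v a r z & rat_eval phi z = w.
Proof.
move=> [c _ cr] e_lt near az0 psi_z0; apply: contrapT => no_preim.
have const z : cball v a r z ->
    v (rat_eval phi z - w) = v (rat_eval phi a - w).
  apply: v_rat_sub_const => x ax; first by case: (near _ ax).
  by apply/eqP => phix; apply: no_preim; exists x.
have az1 : cball v a r (z0 + c).
  by apply/(cballP _ az0); rewrite addrC addKr cr.
have psi_z1 : v (b + u * (z0 + c - a) - w) = v u * r.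
  have -> : z0 + c - a = c + (z0 - a) by rewrite -addrA addrCA.
  by rewrite -psi_z0 opprD addrACA subrr add0r -mulrBr addrK vM cr.
have small : v (rat_eval phi z0 - w) < e by rewrite -psi_z0; case: (near _ az0).
have [_ /lt_trans/(_ e_lt)] := near _ az1; rewrite -psi_z1 => close.
have := vD_dominant close; rewrite addrC addrA subrK psi_z1 const //.
by rewrite -(const _ az0) => vE; have := lt_trans small e_lt; rewrite vE ltxx.
Qed.

Lemma source_union_open N (a : 'I_N -> K) (r : 'I_N -> R) :
  (forall i, 0 < r i) -> open_abs v (source_union v a r).
Proof.
move=> r_gt0 z [i _ az]; exists (r i) => // y zy; exists i => //.
by apply/(cballP _ az).
Qed.
End Ultrametric.

Theorem theorem6p6 (R : realType) (K : closedFieldType) (v : K -> R)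
  (v_abs : nonarch_abs v) (v_complete : complete_abs v)
  (v_div : divisible_value_group v)
  (N : nat) (a : 'I_N -> K) (r : 'I_N -> R) (tau : 'I_N -> 'I_N)
  (b : 'I_N -> K) (t : 'I_N -> R)
  (balls : ball_system v a r t)
  (r_val : forall i, value_group v (r i))
  (t_val : forall i, value_group v (t i))
  (u : 'I_N -> K) (psi : K -> K)
  (psi_aff : piecewise_affine_exact_interpreter v a r tau b t u psi)
  (eps : R) (eps_gt0 : 0 < eps)
  (eps_lt : forall i, eps < v (u i) * r i)
  (phi : {fraction {poly K}})
  (phi_near : (dist_norm v (source_union v a r) phi psi < eps%:E)%E) :
  exact_interpreter v a r tau b t phi.
Proof.
have [r_gt0 _ _] := balls; have [vu psiE psi_exact] := psi_aff.
have near z := dist_norm_lt phi_near (z := z).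
have in_union i z : cball v (a i) (r i) z -> source_union v a r z by exists i.
split.
  exists (source_union v a r); split=> // [|z /near[]//].
  exact: source_union_open.
move=> i; apply/seteqP; split=> [_ [z az <-]|w bw].
  have [_ dist_lt] := near z (in_union i z az).
  have eps_lt_t : eps < t (tau i).
    by rewrite -(divfK (lt0r_neq0 (r_gt0 i)) (t _)) -vu.
  have psi_z : cball v (b (tau i)) (t (tau i)) (psi z).
    by rewrite -psi_exact; exists z.
  by apply/(cballP v_abs _ psi_z)/ltW/(lt_trans dist_lt).
have [z0 az0 psi_z0] : (psi @` cball v (a i) (r i)) w by rewrite psi_exact.
have near_i z : cball v (a i) (r i) z -> regular_at phi z /\
    v (rat_eval phi z - (b (tau i) + u i * (z - a i))) < eps.
  by move=> az; rewrite -(psiE i) //; apply/near/in_union/az.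
rewrite (psiE i) // in psi_z0.
have [z az phi_z] :=
  near_affine_onto v_abs (r_val i) (eps_lt i) near_i az0 psi_z0.
by exists z.
Qed.
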